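(* Let $\mathcal{C}_1$ and $\mathcal{C}_2$ be two $C^3$-smooth planar curves of the same affine arc-length $L$. Let $\mu_1(\alpha)$ and $\mu_2(\alpha)$, $\alpha\in[0,L]$, be their respective affine curvature functions. Assume further that $\mathcal{C}_2$, with affine arc-length parametrization $\gamma_2$, satisfies the initial conditions $\gamma_2(0)=(0,0)$, $\gamma_2'(0)=(1,0)$, $\gamma_2''(0)=(0,1)$. If $\|\mu_1-\mu_2\|_{[0,L]}\le\delta$ and $\hat c=\max\{1,\|\mu_1\|_{[0,L]},\|\mu_2\|_{[0,L]}\}$, then there is $g\in SA(2)$ such that $$d(g\,\mathcal{C}_1,\,\mathcal{C}_2)\le\sqrt2\,\frac{\delta L}{\hat c}\left(e^{\hat cL}-1\right),$$ where $d$ is the Hausdorff distance.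
   Context: A planar curve $\mathcal{C}$ is the image of a continuous, locally injective map $\gamma$ from an interval to $\mathbb{R}^2$ (its parametrization). A $C^3$-smooth planar curve of affine arc-length $L$ is given with its affine arc-length parametrization $\gamma:[0,L]\to\mathbb{R}^2$, $\alpha\mapsto\gamma(\alpha)$, which is three times continuously differentiable and satisfies $\det(\gamma'(\alpha),\gamma''(\alpha))=1$ for all $\alpha$. The vectors $T=\gamma'$ and $N=\gamma''$ are the affine tangent and affine normal. The affine curvature function is $\mu(\alpha)=\det(\gamma''(\alpha),\gamma'''(\alpha))$; equivalently $N'=-\mu T$. $SA(2)$ is the special affine (equi-affine) group of the plane: all transformations $p\mapsto pM^{-1}+v$, with $p\in\mathbb{R}^2$ a row vector, $M$ a real $2\times2$ matrix with $\det M=1$, and $v\in\mathbb{R}^2$. For $g\in SA(2)$, $g\,\mathcal{C}=\{gp : p\in\mathcal{C}\}$. For a continuous function $f$ on $[0,L]$, $\|f\|_{[0,L]}=\max_{t\in[0,L]}|f(t)|$. The Hausdorff distance between subsets $P,Q\subset\mathbb{R}^2$ is $d(P,Q)=\max\{\sup_{p\in P}\inf_{q\in Q}|p-q|,\ \sup_{q\in Q}\inf_{p\in P}|p-q|\}$, with $|\cdot|$ the Euclidean norm. *)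

(* Defs.v *)
From HB Require Import structures.
From mathcomp Require Import all_boot all_order all_algebra.
From mathcomp Require Import all_classical all_reals all_analysis.

Set Implicit Arguments.
Unset Strict Implicit.
Unset Printing Implicit Defensive.
Import Order.TTheory GRing.Theory Num.Theory.
Import numFieldNormedType.Exports.
Local Open Scope classical_set_scope.
Local Open Scope ring_scope.

(* Differentiation relative to a set D: only difference quotients with y in D
   are used, so on D = `[a, b] the derivatives at the endpoints are one-sided
   and the values of f outside D are irrelevant. *)
Section derivative_within.
Context {R : realType} {V : normedModType R}.
Implicit Types (D : set R) (f : R -> V) (x : R) (n : nat).

Definition diff_quotient f x (y : R) : V := (y - x)^-1 *: (f y - f x).

Definition derivable_within D f x : Prop :=
  cvg (diff_quotient f x @ within D x^').

Definition derive_within D f x : V :=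
  lim (diff_quotient f x @ within D x^').

Definition derive_within_n D n f : R -> V := iter n (derive_within D) f.

Definition Cn_within D n f : Prop :=
  (forall k x, (k < n)%N -> D x -> derivable_within D (derive_within_n D k f) x)
  /\ {within D, continuous (derive_within_n D n f)}.

End derivative_within.

Section planar_curves.
Context {R : realType}.
Local Notation plane := 'rV[R]_2.
Implicit Types (gamma : R -> plane) (C P Q : set plane) (I : set R).

Definition pt2 (a b : R) : plane := \row_(j < 2) (if j == 0 then a else b).

Definition det2 (u v : plane) : R := \det (col_mx u v : 'M[R]_2).

(* The normed-space structure of 'rV[R]_2 in the library carries the sup norm. *)
Definition enorm (p : plane) : R := Num.sqrt (\sum_(j < 2) p 0 j ^+ 2).

Definition locally_injective I gamma : Prop :=
  forall t, I t -> exists2 U : set R, nbhs t U &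
    {in U `&` I &, injective gamma}.

Definition planar_curve_param I gamma C : Prop :=
  [/\ {within I, continuous gamma}, locally_injective I gamma
    & C = gamma @` I].

Definition affine_arclength_param (L : R) gamma C : Prop :=
  let D := `[0, L]%classic in
  [/\ planar_curve_param D gamma C, Cn_within D 3 gamma
    & forall a, D a ->
        det2 (derive_within_n D 1 gamma a) (derive_within_n D 2 gamma a) = 1].

Definition affine_curvature (L : R) gamma (a : R) : R :=
  det2 (derive_within_n `[0, L]%classic 2 gamma a)
       (derive_within_n `[0, L]%classic 3 gamma a).

(* For f continuous on [0, L] (L >= 0) this supremum is a maximum. *)
Definition supnorm (L : R) (f : R -> R) : R :=
  sup [set `|f t| | t in `[0, L]%classic].

Definition SA2 : set (plane -> plane) :=
  [set g | exists (M : 'M[R]_2) (v : plane),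
     \det M = 1 /\ g = (fun p => p *m invmx M + v)].

(* Extended-real valued: it may be +oo on unbounded or empty sets. *)
Definition hausdorff_dist P Q : \bar R :=
  maxe (ereal_sup [set ereal_inf [set (enorm (p - q))%:E | q in Q] | p in P])
       (ereal_sup [set ereal_inf [set (enorm (p - q))%:E | p in P] | q in Q]).

End planar_curves.

(* Main.v *)
Require Import Defs.
From HB Require Import structures.
From mathcomp Require Import all_boot all_order all_algebra.
From mathcomp Require Import all_classical all_reals all_analysis.
From mathcomp Require Import ring lra.

Set Implicit Arguments.
Unset Strict Implicit.
Unset Printing Implicit Defensive.
Import Order.TTheory GRing.Theory Num.Theory.
Import numFieldNormedType.Exports.
Local Open Scope classical_set_scope.
Local Open Scope ring_scope.

(** The matrix of g carries the initial frame (T1, N1) of the first curve to the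
canonical frame, which is the one of the second curve, and the translation
matches the starting points. It remains to compare two curves with the same
initial data and close affine curvatures. The estimate is pointwise: both
curves are parametrized over the same interval, so a bound on the distance of
the points with equal parameter bounds the Hausdorff distance
([hausdorff_dist_image_le]). It is enough to bound each of the two coordinates,
at the price of the factor sqrt 2 ([enorm_le_sqrt2]).

Every linear coordinate x of a curve satisfies x' = t, t' = n, n' = - mu t: the
last equation ([affine_normal_derivative]) follows from differentiating
det(T, N) = 1, which shows that N' is parallel to T. In the max norm on pairs
(t, n) this linear system has operator norm at most c = chat, because
c >= max(1, |mu|). Hence |t|, |n| <= exp(c s) when the initial data are at most
1. The differences of the two t and of the two n vanish at 0 and satisfy the
first system up to the forcing term (mu1 - mu2) t2, which is at most
delta exp(c s); so they are at most delta s exp(c s). Both bounds are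
instances of [gronwall_pair]. Bounding s by L in the last one and integrating
once more gives delta L / c * (exp(c s) - 1) for the difference of the two x
([component_gap]).

All integrations are replaced by comparisons of derivatives through the mean
value theorem ([increment_le_dominating]). These need derivatives only in the
open interval, plus continuity up to the endpoints; besides the initial frame,
the one-sided derivatives at 0 and L therefore enter only through the
continuity that they imply. *)

(** * Differential inequalities on an interval *)

Section differential_inequalities.
Context {R : realType}.
Implicit Types (L a c d : R) (f df g dg u v du dv : R -> R).

(** The hypotheses of the mean value theorem: two-sided derivatives inside the
    interval, continuity up to its endpoints. *)
Definition primitive_on L f df : Prop :=
  {within `[0, L], continuous f} /\
  forall x : R, x \in `]0, L[ -> is_derive x (1 : R) f (df x).

Lemma primitive_onB L f df g dg :
  primitive_on L f df -> primitive_on L g dg ->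
  primitive_on L (fun x => f x - g x) (fun x => df x - dg x).
Proof.
move=> [cf f'] [cg g']; split=> [x|x x0L]; last exact: (is_deriveB (f' x x0L) (g' x x0L)).
by apply: cvgB; [exact: cf|exact: cg].
Qed.

Lemma primitive_onZ L f df (k : R) :
  primitive_on L f df -> primitive_on L (fun x => k * f x) (fun x => k * df x).
Proof.
move=> [cf f']; split=> [x|x x0L]; last exact: (is_deriveZ k (f' x x0L)).
by apply: cvgM; [exact: cvg_cst|exact: cf].
Qed.

Lemma primitive_on_everywhere L f df :
  (forall x : R, is_derive x (1 : R) f (df x)) -> primitive_on L f df.
Proof.
move=> f'; split=> [|x _]; last exact: f'.
apply: continuous_subspaceT => x; apply: differentiable_continuous.
by apply/derivable1_diffP; case: (f' x).
Qed.

Lemma is_derive_expR_scaled (k x : R) :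
  is_derive x (1 : R) (fun y => expR (k * y)) (k * expR (k * x)).
Proof.
have k' : is_derive x (1 : R) (fun y => k * y) k.
  by have := is_deriveZ k (is_derive_id x (1 : R)); rewrite /GRing.scale /= mulr1.
by rewrite mulrC; apply: is_derive1_comp k'; exact: is_derive_expR.
Qed.

(** Stands in for integrating the inequality of derivatives over [0, t]: both
    g - f and g + f have a nonnegative derivative. *)
Lemma increment_le_dominating L f df g dg :
  primitive_on L f df -> primitive_on L g dg ->
  (forall x : R, x \in `]0, L[ -> `|df x| <= dg x) ->
  forall t, t \in `[0, L] -> `|f t - f 0| <= g t - g 0.
Proof.
move=> pf pg dfg t; rewrite in_itv /= => /andP[t_ge0 tL].
have sign_le (e : R) : `|e| = 1 -> e * (f t - f 0) <= g t - g 0.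
  move=> e1; have [ch h'] := primitive_onB pg (primitive_onZ e pf).
  have sub x : x \in `]0, t[ -> x \in `]0, L[.
    by rewrite !in_itv /= => /andP[-> /lt_le_trans]; exact.
  have ch0t : {within `[0, t], continuous (fun x => g x - e * f x)}.
    by apply: continuous_subspaceW ch; apply: subset_itvl; exact: tL.
  move: t_ge0; rewrite le_eqVlt => /predU1P[<-|t_gt0].
    by rewrite !subrr mulr0.
  have [x x0t] := MVT t_gt0 (fun x x0t => h' x (sub x x0t)) ch0t.
  rewrite subr0 => ht.
  have : 0 <= (dg x - e * df x) * t.
    apply: mulr_ge0 (ltW t_gt0).
    rewrite subr_ge0 (le_trans (ler_norm _))//.
    by rewrite normrM e1 mul1r; exact/dfg/sub.
  rewrite -ht; lra.
rewrite ler_norml -(opprK (f t - f 0)) lerN2.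
have := sign_le 1; have := sign_le (-1).
rewrite normrN normr1 => /(_ erefl) + /(_ erefl); lra.
Qed.

(** The function phi = (a + d t) exp(c t) on the right solves the extremal
    equation phi' = c phi + d exp(c t), phi(0) = a. If the maximum K of
    (max(|u|, |v|) - phi) exp(- c t) were positive, then
    psi = phi + K exp(c t) would be another solution of this equation which
    dominates |u| and |v|. Integrating the hypotheses with this bound gives
    |u|, |v| <= psi - K, since psi exceeds a by K at 0, and that contradicts
    max(|u|, |v|) = psi at the point where K is attained. The argument never
    differentiates the maximum of two absolute values. *)
Lemma gronwall_pair L c a d u v du dv :
  0 <= L ->
  primitive_on L u du -> primitive_on L v dv ->
  (forall x : R, x \in `]0, L[ ->
     `|du x| <= c * Num.max `|u x| `|v x| + d * expR (c * x)) ->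
  (forall x : R, x \in `]0, L[ ->
     `|dv x| <= c * Num.max `|u x| `|v x| + d * expR (c * x)) ->
  0 <= c -> `|u 0| <= a -> `|v 0| <= a ->
  forall t, t \in `[0, L] ->
    Num.max `|u t| `|v t| <= (a + d * t) * expR (c * t).
Proof.
move=> L_ge0 pu pv u' v' c_ge0 u0 v0.
pose m (x : R) : R := Num.max `|u x| `|v x|.
pose phi (x : R) : R := (a + d * x) * expR (c * x).
pose psi (K x : R) : R := phi x + K * expR (c * x).
pose excess (x : R) : R := (m x - phi x) * expR (- c * x).
have dpsi (K x : R) : is_derive x (1 : R) (psi K)
    (c * psi K x + d * expR (c * x)).
  have lin' : is_derive x (1 : R) (fun x => (a + K) + d * x) d.
    have := is_deriveD (is_derive_cst (a + K) x 1)
                       (is_deriveZ d (is_derive_id x (1 : R))).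
    by rewrite add0r /GRing.scale /= mulr1.
  have -> : psi K = (fun x => ((a + K) + d * x) * expR (c * x)).
    by apply/funext => y; rewrite /psi /phi; ring.
  apply: is_derive_eq (is_deriveM lin' (is_derive_expR_scaled c x)) _.
  rewrite /GRing.scale /=; ring.
have cont_exp k : {within `[0, L], continuous (fun x : R => expR (k * x))}.
  by have [] := primitive_on_everywhere L (is_derive_expR_scaled k).
have c_excess : {within `[0, L], continuous excess}.
  move=> x; apply: cvgM; last exact: cont_exp.
  apply: cvgB; last first.
    have [+ _] := primitive_on_everywhere L (dpsi 0).
    rewrite (_ : psi 0 = phi); first by apply.
    by apply/funext => y; rewrite /psi mul0r addr0.
  have cu : {for x, continuous (fun y : subspace `[0, L] => `|u y|)}.
    by apply: cvg_norm; exact: pu.1.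
  have cv : {for x, continuous (fun y : subspace `[0, L] => `|v y|)}.
    by apply: cvg_norm; exact: pv.1.
  exact: (@continuous_max _ (subspace `[0, L]) (fun y => `|u y|)
    (fun y => `|v y|) x cu cv).
have [s s0L max_s] := EVT_max L_ge0 c_excess.
have m_le x : x \in `[0, L] -> m x <= psi (excess s) x.
  move=> /max_s; rewrite {1}/excess /psi -lerBlDl mulNr expRN.
  by rewrite ler_pdivrMr ?expR_gt0.
have excess_le0 : excess s <= 0.
  rewrite leNgt; apply/negP => K_gt0.
  have bound w dw : primitive_on L w dw -> `|w 0| <= a ->
      (forall x : R, x \in `]0, L[ ->
         `|dw x| <= c * Num.max `|u x| `|v x| + d * expR (c * x)) ->
      `|w s| <= psi (excess s) s - excess s.
    move=> pw w0 w'.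
    have incr := increment_le_dominating pw (primitive_on_everywhere L (dpsi (excess s))).
    have /incr/(_ s s0L) : forall x : R, x \in `]0, L[ ->
        `|dw x| <= c * psi (excess s) x + d * expR (c * x).
      move=> x x0L; apply: le_trans (w' x x0L) _.
      rewrite lerD2r ler_wpM2l //; apply: m_le.
      by apply: subset_itv_oo_cc x0L.
    have := lerB_dist (w s) (w 0).
    have -> : psi (excess s) 0 = a + excess s.
      by rewrite /psi /phi !mulr0 expR0 addr0 !mulr1.
    lra.
  have : m s <= psi (excess s) s - excess s.
    by rewrite ge_max !(bound _ _ pu, bound _ _ pv).
  have -> : m s = psi (excess s) s.
    rewrite /psi /excess -mulrA -expRD mulNr addNr expR0; ring.
  by lra.
move=> t t0L; apply: le_trans (m_le t t0L) _.
by rewrite /psi gerDl mulr_le0_ge0 ?expR_ge0.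
Qed.

End differential_inequalities.

(** * From derivatives relative to an interval to scalar primitives *)

Section one_sided_derivatives.
Context {R : realType}.
Implicit Types (L x : R).

Lemma cvg_diff_quotient_scalar (V : normedModType R) (D : set R) (f : R -> V) x
    (phi : {scalar V}) :
  continuous phi -> derivable_within D f x ->
  diff_quotient (phi \o f : R -> R^o) x @ within D x^' -->
    (phi (derive_within D f x) : R^o).
Proof.
move=> cphi f'.
have -> : diff_quotient (phi \o f : R -> R^o) x = phi \o diff_quotient f x.
  apply/funext => y.
  by rewrite /diff_quotient /= [RHS]linearZ (linearB phi).
exact: cvg_comp f' (cphi _).
Qed.

(** Inside the interval, difference quotients relative to it are eventually the
    ordinary ones; at every point, endpoints included, their convergence gives
    continuity relative to the interval. *)
Lemma cvg_diff_quotient_primitive_on L (f df : R -> R) :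
  (forall x, x \in `[0, L] ->
     diff_quotient (f : R -> R^o) x @ within `[0, L] x^' --> (df x : R^o)) ->
  primitive_on L f df.
Proof.
move=> f'; split=> [|x x0L].
  apply/subspace_continuousP => x /f' q_cvg.
  have punct : f @ within `[0, L] x^' --> f x.
    have lin : (fun y => f x + (y - x) * diff_quotient (f : R -> R^o) x y)
        @ within `[0, L] x^' --> f x + (x - x) * df x.
      apply: cvgD; first exact: cvg_cst.
      apply: cvgM => //; apply: cvgB; last exact: cvg_cst.
      apply: cvg_within_filter; apply: cvg_within_filter; exact: cvg_id.
    rewrite subrr mul0r addr0 in lin.
    apply: cvg_trans lin; apply: near_eq_cvg.
    rewrite near_withinE; near=> y => _.
    have yx : y - x != 0 by rewrite subr_eq0; near: y; exact: nbhs_dnbhs_neq.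
    by rewrite /diff_quotient /GRing.scale /= mulrA mulfV // mul1r addrC subrK.
  move=> U Ux; have : nbhs x (fun y => y != x -> y \in `[0, L] -> U (f y)).
    exact: punct.
  apply: filterS => y Uy y0L.
  by have [->|yx] := eqVneq y x; [exact: (nbhs_singleton Ux)|exact: Uy].
have shift0 (P : set R) : nbhs x P -> \forall h \near 0, P (h + x).
  have : (fun h : R => h + x) @ nbhs 0 --> 0 + x.
    by apply: cvgD; [exact: cvg_id|exact: cvg_cst].
  by rewrite add0r; exact.
have q_cvg : (fun h : R => h^-1 *: (f (h + x) - f x : R^o)) @ 0^' --> (df x : R^o).
  have /f' := subset_itv_oo_cc x0L.
  move=> dfx U Udf.
  have Uq : nbhs x (fun y => y != x -> y \in `[0, L] ->
      U ((y - x)^-1 *: (f y - f x : R^o))) by exact: dfx.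
  suff : nbhs (0 : R) (fun h => h != 0 -> U (h^-1 *: (f (h + x) - f x : R^o))) by [].
  have {}Uq : \forall h \near 0, (fun y => y != x -> y \in `[0, L] ->
      U ((y - x)^-1 *: (f y - f x : R^o))) (h + x) by exact: (shift0 _ Uq).
  have in0L : \forall h \near 0, h + x \in `]0, L[.
    by exact: (shift0 _ (near_in_itvoo x0L)).
  apply: filterS2 Uq in0L => h Uq in0L h0.
  have := Uq; rewrite /= addrK; apply; last exact: subset_itv_oo_cc.
  by rewrite -subr_eq0 addrK.
have dfE : (fun h : R => h^-1 *: (f (h *: (1 : R) + x) - f x : R^o)) @ 0^' -->
    (df x : R^o).
  by under eq_fun do rewrite /GRing.scale /= mulr1.
by apply: DeriveDef; [apply/cvg_ex; exists (df x)|exact: cvg_lim].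
Unshelve. all: by end_near. Qed.

(** Continuity is what makes the set of values bounded: the supremum of an
    unbounded set has a junk value. *)
Lemma supnorm_ge L (f : R -> R) x :
  {within `[0, L], continuous f} -> x \in `[0, L] -> `|f x| <= supnorm L f.
Proof.
move=> cf x0L.
have L_ge0 : 0 <= L.
  by move: x0L; rewrite in_itv /= => /andP[]; exact: le_trans.
have [|c _ max_c] := @EVT_max _ (fun y => `|f y|) _ _ L_ge0.
  by move=> y; apply: cvg_norm; exact: cf.
apply: ub_le_sup; last by exists x.
by exists `|f c| => _ [y y0L <-]; exact: max_c.
Qed.

End one_sided_derivatives.

(** * Affine frames of planar curves *)

Section planar_curves.
Context {R : realType}.
Implicit Types (L x : R) (A : 'M[R]_2) (j : 'I_2) (p u v : 'rV[R]_2).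
Local Notation derive_n L k gamma := (derive_within_n `[0, L]%classic k gamma).

(** With A = 1 this is a coordinate of p, and with A the inverse of a frame it
    is a coordinate of p in that frame: both curves are treated by the same
    lemmas. *)
Definition frame_coord A j p : R := (p *m A) 0 j.

Fact frame_coord_is_scalar A j : scalar (frame_coord A j).
Proof. by move=> k u v; rewrite /frame_coord mulmxDl -scalemxAl !mxE. Qed.

HB.instance Definition _ A j :=
  GRing.isLinear.Build R 'rV[R]_2 R _ (frame_coord A j) (frame_coord_is_scalar A j).

Lemma frame_coord1 T (f : T -> 'rV[R]_2) j :
  frame_coord 1%:M j \o f = fun t => f t 0 j.
Proof. by apply/funext => t; rewrite /= /frame_coord mulmx1. Qed.

Lemma continuous_frame_coord A j : continuous (frame_coord A j).
Proof.
have -> : frame_coord A j = fun p => p 0 0 * A 0 j + p 0 (lift 0 0) * A (lift 0 0) j.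
  by apply/funext => p; rewrite /frame_coord mxE big_ord_recl big_ord1.
have c k (p : 'rV[R]_2) :
    (fun q : 'rV[R]_2 => q 0 k * A k j) @ nbhs p --> p 0 k * A k j.
  exact: (cvgM (@coord_continuous _ _ _ 0 k p) (cvg_cst (A k j))).
by move=> p; exact: (cvgD (c _ p) (c _ p)).
Qed.

Lemma det2E u v : det2 u v = u 0 0 * v 0 1 - u 0 1 * v 0 0.
Proof.
have s0 : fintype.split (0 : 'I_(1 + 1)) = inl 0.
  by rewrite -[RHS]unsplitK; congr fintype.split; exact: val_inj.
have s1 : fintype.split (lift 0 0 : 'I_(1 + 1)) = inr 0.
  by rewrite -[RHS]unsplitK; congr fintype.split; exact: val_inj.
rewrite /det2 (expand_det_row _ 0) big_ord_recl big_ord1 /cofactor !det_mx11 !mxE.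
rewrite s0 s1 (_ : lift ord0 0 = 1); last exact: val_inj.
rewrite /= addn0 expr0 /bump /= add0n expr1 (_ : lift 1 0 = ord0); [ring|exact: val_inj].
Qed.

Lemma frame_to_canonical u v (M := col_mx u v : 'M[R]_2) :
  det2 u v = 1 -> u *m invmx M = pt2 1 0 /\ v *m invmx M = pt2 0 1.
Proof.
move=> det1.
have MA : col_mx (u *m invmx M) (v *m invmx M) = 1%:M.
  by rewrite -mul_col_mx; apply: mulmxV; rewrite unitmxE [\det _]det1 unitr1.
split; [rewrite -[LHS](col_mxKu _ (v *m invmx M))|
        rewrite -[LHS](col_mxKd (u *m invmx M))]; rewrite MA.
all: by apply/rowP => j; rewrite !mxE; case: j => [[|[|//]] ?].
Qed.

Lemma curve_coord_primitive L gamma A j k :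
  Cn_within `[0, L] 3 gamma -> (k < 3)%N ->
  primitive_on L (frame_coord A j \o derive_n L k gamma)
                 (frame_coord A j \o derive_n L k.+1 gamma).
Proof.
move=> [gamma' _] k3; apply: cvg_diff_quotient_primitive_on => x x0L.
exact: (cvg_diff_quotient_scalar (@continuous_frame_coord A j) (gamma' k x k3 x0L)).
Qed.

Lemma curve_coord_continuous L gamma A j k :
  Cn_within `[0, L] 3 gamma -> (k <= 3)%N ->
  {within `[0, L], continuous (frame_coord A j \o derive_n L k gamma)}.
Proof.
move=> G; rewrite leq_eqVlt => /predU1P[->|k3]; last first.
  by have [] := curve_coord_primitive A j G k3.
have [_ /subspace_continuousP cg] := G.
apply/subspace_continuousP => x /cg gx.
apply: (@cvg_comp _ _ _ (derive_n L 3 gamma) (frame_coord A j) _ _ _ gx).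
exact: continuous_frame_coord.
Qed.

Lemma affine_curvature_continuous L gamma :
  Cn_within `[0, L] 3 gamma -> {within `[0, L], continuous (affine_curvature L gamma)}.
Proof.
move=> G.
have c j k : (k <= 3)%N ->
    {within `[0, L], continuous (fun x => derive_n L k gamma x 0 j)}.
  by move=> k3; rewrite -frame_coord1; exact: curve_coord_continuous.
have -> : affine_curvature L gamma = (fun x =>
    derive_n L 2 gamma x 0 0 * derive_n L 3 gamma x 0 1 -
    derive_n L 2 gamma x 0 1 * derive_n L 3 gamma x 0 0).
  by apply/funext => x; rewrite /affine_curvature det2E.
by move=> x; apply: cvgB; apply: cvgM; exact: c.
Qed.

(** The products n0 n1 cancel when n0 and n1 are the derivatives of t0 and t1,
    so only the second derivatives remain. *)
Lemma is_derive_wronskian (t0 n0 t1 n1 : R -> R) x dn0 dn1 :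
  is_derive x (1 : R) t0 (n0 x) -> is_derive x (1 : R) n0 dn0 ->
  is_derive x (1 : R) t1 (n1 x) -> is_derive x (1 : R) n1 dn1 ->
  is_derive x (1 : R) (fun y => t0 y * n1 y - t1 y * n0 y)
    (t0 x * dn1 - t1 x * dn0).
Proof.
move=> t0' n0' t1' n1'.
have := is_deriveB (is_deriveM t0' n1') (is_deriveM t1' n0').
have -> : t0 x *: dn1 + n1 x *: n0 x - (t1 x *: dn0 + n0 x *: n1 x) =
          t0 x * dn1 - t1 x * dn0 by rewrite /GRing.scale /=; ring.
exact.
Qed.

(** In the unimodular basis (t, n) the coordinates of m are det(m, n) and
    det(t, m) = 0; hence m = - det(n, m) t. *)
Lemma cramer2 (t0 t1 n0 n1 m0 m1 : R) :
  t0 * n1 - t1 * n0 = 1 -> t0 * m1 - t1 * m0 = 0 ->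
  m0 = - (n0 * m1 - n1 * m0) * t0 /\ m1 = - (n0 * m1 - n1 * m0) * t1.
Proof.
move=> det1 det0; split; apply/eqP; rewrite mulNr -addr_eq0; apply/eqP.
- transitivity (m0 * (1 - (t0 * n1 - t1 * n0)) + n0 * (t0 * m1 - t1 * m0)).
    by ring.
  by rewrite det1 det0 subrr !mulr0 addr0.
- transitivity (m1 * (1 - (t0 * n1 - t1 * n0)) + n1 * (t0 * m1 - t1 * m0)).
    by ring.
  by rewrite det1 det0 subrr !mulr0 addr0.
Qed.

(** Differentiating det(T, N) = 1 gives det(T, N') = 0, since the term
    det(T', N) = det(N, N) vanishes; so N' is a multiple of T, and the factor is
    read off from det(N, N'). *)
Lemma affine_normal_derivative L gamma C x :
  affine_arclength_param L gamma C -> x \in `]0, L[ ->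
  derive_n L 3 gamma x =
  - affine_curvature L gamma x *: derive_n L 1 gamma x.
Proof.
move=> [_ G unit_det] x0L.
pose D j k y := derive_n L k gamma y 0 j.
have D' j k : (k < 3)%N -> is_derive x (1 : R) (D j k) (D j k.+1 x).
  move=> k3; have [_ /(_ x x0L)] := curve_coord_primitive 1%:M j G k3.
  by rewrite !frame_coord1.
have det1 y : y \in `[0, L] -> D 0 1%N y * D 1 2 y - D 1 1%N y * D 0 2 y = 1.
  by move=> /unit_det; rewrite det2E.
have det' : is_derive x (1 : R) (fun y => D 0 1%N y * D 1 2 y - D 1 1%N y * D 0 2 y)
    (D 0 1%N x * D 1 3 x - D 1 1%N x * D 0 3 x).
  exact: is_derive_wronskian (D' 0 1%N isT) (D' 0 2 isT) (D' 1 1%N isT) (D' 1 2 isT).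
have tangential : D 0 1%N x * D 1 3 x - D 1 1%N x * D 0 3 x = 0.
  have const : is_derive x (1 : R) (fun y => D 0 1%N y * D 1 2 y - D 1 1%N y * D 0 2 y) 0.
    apply: near_eq_is_derive (is_derive_cst (1 : R) x (1 : R)).
    near=> y; rewrite det1 //; apply: subset_itv_oo_cc.
    by near: y; exact: near_in_itvoo.
  by have [_ <-] := det'; have [_ ->] := const.
have {}det1 := det1 x (subset_itv_oo_cc x0L).
apply/rowP => j; rewrite !mxE /affine_curvature det2E.
have [m0E m1E] := cramer2 det1 tangential.
by have [->|->] : j = 0 \/ j = 1
  by case: j => [[|[|//]] ?]; [left|right]; exact: val_inj.
Unshelve. all: by end_near. Qed.

Lemma coord_normal_primitive L gamma C A j :
  affine_arclength_param L gamma C ->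
  primitive_on L (frame_coord A j \o derive_n L 2 gamma)
    (fun x => - affine_curvature L gamma x * frame_coord A j (derive_n L 1 gamma x)).
Proof.
move=> H; have [_ G _] := H.
have [c n'] := curve_coord_primitive A j G (isT : 2 < 3)%N.
split=> // x x0L; have := n' x x0L.
have -> // : (frame_coord A j \o derive_n L 3 gamma) x =
    - affine_curvature L gamma x * frame_coord A j (derive_n L 1 gamma x).
by rewrite compE (affine_normal_derivative H x0L) linearZ.
Qed.

End planar_curves.

(** * Comparison of two curves *)

Lemma hausdorff_dist_image_le {R : realType} (T : Type) (D : set T)
    (f g : T -> 'rV[R]_2) (b : R) :
  (forall t, D t -> enorm (f t - g t) <= b) ->
  (hausdorff_dist (f @` D) (g @` D) <= b%:E)%E.
Proof.
move=> fg; rewrite /hausdorff_dist ge_max; apply/andP; split;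
  apply: ge_ereal_sup => _ [_ [t Dt <-] <-].
- apply: (@le_trans _ _ (enorm (f t - g t))%:E); last by rewrite lee_fin fg.
  by apply: ereal_inf_lbound; exists (g t) => //; exists t.
- apply: (@le_trans _ _ (enorm (f t - g t))%:E); last by rewrite lee_fin fg.
  by apply: ereal_inf_lbound; exists (f t) => //; exists t.
Qed.

Lemma enorm_le_sqrt2 {R : realType} (p : 'rV[R]_2) (b : R) :
  (forall j, `|p 0 j| <= b) -> enorm p <= Num.sqrt 2 * b.
Proof.
move=> pb; have b_ge0 : 0 <= b := le_trans (normr_ge0 _) (pb 0).
rewrite -[b in leRHS](ger0_norm b_ge0) -sqrtr_sqr -sqrtrM // /enorm.
rewrite ler_sqrt ?mulr_ge0 ?sqr_ge0 // big_ord_recl big_ord1 mulr_natl mulr2n.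
by apply: lerD; rewrite -real_normK ?num_real // lerXn2r ?nnegrE ?pb.
Qed.

(** The two rows of the system for the differences: t1 - t2 has derivative
    n1 - n2, and n1 - n2 has derivative - mu1 (t1 - t2) - (mu1 - mu2) t2, where
    c bounds the coefficients 1 and mu1, and delta exp(c s) bounds the forcing
    term. *)
Lemma component_gap {R : realType} (L c delta : R) (x1 t1 n1 x2 t2 n2 mu1 mu2 : R -> R) :
  0 < L -> 1 <= c ->
  primitive_on L x1 t1 -> primitive_on L t1 n1 ->
  primitive_on L n1 (fun s => - mu1 s * t1 s) ->
  primitive_on L x2 t2 -> primitive_on L t2 n2 ->
  primitive_on L n2 (fun s => - mu2 s * t2 s) ->
  (forall s, s \in `]0, L[ -> `|mu1 s| <= c) ->
  (forall s, s \in `]0, L[ -> `|mu2 s| <= c) ->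
  (forall s, s \in `]0, L[ -> `|mu1 s - mu2 s| <= delta) ->
  t1 0 = t2 0 -> n1 0 = n2 0 -> `|t2 0| <= 1 -> `|n2 0| <= 1 ->
  forall s, s \in `[0, L] ->
    `|(x1 s - x1 0) - (x2 s - x2 0)| <= delta * L / c * (expR (c * L) - 1).
Proof.
move=> L_gt0 c_ge1 x1' t1' n1' x2' t2' n2' mu1c mu2c mu12 t12 n12 t20 n20.
have d_ge0 : 0 <= delta.
  apply: le_trans (normr_ge0 _) (mu12 (L / 2) _).
  by rewrite in_itv /= divr_gt0 // gtr_pMr // invf_lt1 // ltr1n.
have c_gt0 : 0 < c := lt_le_trans ltr01 c_ge1.
have c_ge0 := ltW c_gt0.
have le_maxlr (u v : R) : u <= Num.max u v /\ v <= Num.max u v.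
  by rewrite !le_max !lexx orbT.
(* The case a = 1, d = 0 of the pair estimate. *)
have frame2 s : s \in `[0, L] -> `|t2 s| <= expR (c * s).
  move=> s0L; have : Num.max `|t2 s| `|n2 s| <= (1 + 0 * s) * expR (c * s).
    apply: (gronwall_pair (ltW L_gt0) t2' n2') => // r r0L; rewrite mul0r addr0.
      rewrite -[X in X <= _]mul1r ler_pM // ?(le_maxlr _ _).2 //.
    by rewrite normrM normrN ler_pM ?mu2c // (le_maxlr _ _).1.
  by rewrite mul0r addr0 mul1r ge_max => /andP[].
have Dx := primitive_onB x1' x2'.
have Dt := primitive_onB t1' t2'.
have Dn := primitive_onB n1' n2'.
(* The case a = 0, d = delta. *)
have frame_gap s : s \in `[0, L] -> `|t1 s - t2 s| <= delta * s * expR (c * s).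
  move=> s0L.
  have /(_ s s0L) : forall s, s \in `[0, L] ->
      Num.max `|t1 s - t2 s| `|n1 s - n2 s| <= (0 + delta * s) * expR (c * s).
    apply: (gronwall_pair (ltW L_gt0) Dt Dn) => //.
    - move=> r r0L; rewrite -[leLHS]addr0 lerD ?mulr_ge0 ?expR_ge0 //.
      by rewrite -[leLHS]mul1r ler_pM // (le_maxlr _ _).2.
    - move=> r r0L.
      have -> : - mu1 r * t1 r - (- mu2 r * t2 r) =
          - mu1 r * (t1 r - t2 r) + - (mu1 r - mu2 r) * t2 r by ring.
      apply: le_trans (ler_normD _ _) _; rewrite !normrM !normrN.
      apply: lerD; first by rewrite ler_pM ?mu1c // (le_maxlr _ _).1.
      by rewrite ler_pM ?mu12 ?frame2 //; exact: subset_itv_oo_cc.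
    - by rewrite t12 subrr normr0.
    - by rewrite n12 subrr normr0.
  by rewrite ge_max add0r => /andP[].
have dexp (r : R) : is_derive r (1 : R) (fun s => delta * L / c * expR (c * s))
    (delta * L * expR (c * r)).
  have := is_deriveZ (delta * L / c) (is_derive_expR_scaled c r).
  have -> // : delta * L / c *: (c * expR (c * r)) = delta * L * expR (c * r).
  by rewrite /GRing.scale /= mulrA divfK // lt0r_neq0.
move=> s s0L.
have /(_ s s0L) : forall s, s \in `[0, L] ->
    `|(x1 s - x2 s) - (x1 0 - x2 0)| <=
    delta * L / c * expR (c * s) - delta * L / c * expR (c * 0).
  apply: increment_le_dominating Dx (primitive_on_everywhere L dexp) _ => r r0L.
  have r0L' := subset_itv_oo_cc r0L; apply: le_trans (frame_gap r r0L') _.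
  rewrite ler_wpM2r ?expR_ge0 // ler_wpM2l //.
  by move: r0L'; rewrite in_itv /= => /andP[].
have -> : x1 s - x2 s - (x1 0 - x2 0) = (x1 s - x1 0) - (x2 s - x2 0) by ring.
move=> gap; apply: le_trans gap _.
rewrite mulr0 expR0 -mulrBr ler_wpM2l //.
  by rewrite divr_ge0 // mulr_ge0 // ltW.
rewrite lerD2r ler_expR ler_wpM2l //.
by move: s0L; rewrite in_itv /= => /andP[].
Qed.

Theorem theorem19 (R : realType) (L delta : R)
    (gamma1 gamma2 : R -> 'rV[R]_2) (C1 C2 : set 'rV[R]_2)
    (L_gt0 : 0 < L)
    (HC1 : affine_arclength_param L gamma1 C1)
    (HC2 : affine_arclength_param L gamma2 C2)
    (gamma2_0 : gamma2 0 = pt2 0 0)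
    (T2_0 : derive_within_n `[0, L]%classic 1 gamma2 0 = pt2 1 0)
    (N2_0 : derive_within_n `[0, L]%classic 2 gamma2 0 = pt2 0 1) :
  let mu1 := affine_curvature L gamma1 in
  let mu2 := affine_curvature L gamma2 in
  let chat := Num.max 1 (Num.max (supnorm L mu1) (supnorm L mu2)) in
  supnorm L (fun a => mu1 a - mu2 a) <= delta ->
  exists2 g : 'rV[R]_2 -> 'rV[R]_2, SA2 g &
    (hausdorff_dist (g @` C1) C2 <=
       (Num.sqrt 2 * (delta * L / chat) * (expR (chat * L) - 1))%:E)%E.
Proof.
move=> mu1 mu2 chat mu_close.
have [[_ _ ->] G1 unit_det] := HC1; have [[_ _ ->] G2 _] := HC2.
have zero0L : 0 \in `[0, L] by rewrite in_itv /= lexx ltW.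
pose M := col_mx (derive_within_n `[0, L]%classic 1 gamma1 0)
                 (derive_within_n `[0, L]%classic 2 gamma1 0) : 'M[R]_2.
pose A := invmx M.
have detM : \det M = 1 by exact: unit_det.
(* In the coordinates given by A, the first curve starts with the same frame
   as the second one. *)
have [T1_0 N1_0] := frame_to_canonical detM.
exists (fun p => p *m A - gamma1 0 *m A); first by exists M, (- (gamma1 0 *m A)).
rewrite image_comp; apply: hausdorff_dist_image_le => t t0L /=.
rewrite -mulrA; apply: enorm_le_sqrt2 => j.
have le_supnorm (f : R -> R) : {within `[0, L], continuous f} ->
    forall s, s \in `]0, L[ -> `|f s| <= supnorm L f.
  by move=> cf s s0L; apply: supnorm_ge => //; exact: subset_itv_oo_cc.
have c1 : {within `[0, L], continuous mu1} := affine_curvature_continuous G1.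
have c2 : {within `[0, L], continuous mu2} := affine_curvature_continuous G2.
have le_max3 (a b c : R) : [/\ a <= Num.max a (Num.max b c),
    b <= Num.max a (Num.max b c) & c <= Num.max a (Num.max b c)].
  by split; rewrite !le_max lexx ?orbT.
have [chat_ge1 le_chat1 le_chat2] : [/\ 1 <= chat, supnorm L mu1 <= chat &
  supnorm L mu2 <= chat] := le_max3 _ _ _.
have mu1_le s (s0L : s \in `]0, L[) : `|mu1 s| <= chat :=
  le_trans (le_supnorm mu1 c1 s s0L) le_chat1.
have mu2_le s (s0L : s \in `]0, L[) : `|mu2 s| <= chat :=
  le_trans (le_supnorm mu2 c2 s s0L) le_chat2.
have c12 : {within `[0, L], continuous (fun a => mu1 a - mu2 a)}.
  by move=> a; apply: cvgB; [exact: c1|exact: c2].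
have mu12_le s (s0L : s \in `]0, L[) : `|mu1 s - mu2 s| <= delta :=
  le_trans (le_supnorm _ c12 s s0L) mu_close.
have pt2_le1 (a b : R) : `|a| <= 1 -> `|b| <= 1 -> `|pt2 a b 0 j| <= 1.
  by rewrite mxE; case: ifP.
have := component_gap L_gt0 chat_ge1
  (curve_coord_primitive A j G1 (isT : 0 < 3)%N)
  (curve_coord_primitive A j G1 (isT : 1 < 3)%N) (coord_normal_primitive A j HC1)
  (curve_coord_primitive 1%:M j G2 (isT : 0 < 3)%N)
  (curve_coord_primitive 1%:M j G2 (isT : 1 < 3)%N) (coord_normal_primitive 1%:M j HC2)
  mu1_le mu2_le mu12_le.
rewrite !frame_coord1 !compE T2_0 N2_0 /frame_coord T1_0 N1_0 => gap.
have pt20_0 : pt2 0 0 = 0 :> 'rV[R]_2 by apply/rowP => i; rewrite !mxE if_same.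
have T_le1 : `|pt2 1 0 0 j| <= 1 :> R by rewrite pt2_le1 ?normr0 ?normr1.
have N_le1 : `|pt2 0 1 0 j| <= 1 :> R by rewrite pt2_le1 ?normr0 ?normr1.
have := gap erefl erefl T_le1 N_le1 t t0L.
by rewrite /= gamma2_0 pt20_0 !mxE subr0.
Qed.
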